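(* Let $X\subset\mathcal L$, $f\in X$, $n\ge1$, $\alpha\in(0,1)$, and let $Y_i=f\left(\frac{i-1}{n}\right)+\epsilon_i$, $i=1,\dots,n$, where $\epsilon_1,\dots,\epsilon_n$ are independent real random variables with mean zero such that for some $\kappa>0$, $v>0$ and all integers $m\ge2$ one has $\mathbb E|\epsilon_i|^m\le v\,m!\,\kappa^{m-2}/2$ for all $i$. Let $k\in\mathbb N_0$ be such that $f^{(n)}\in X_k^{(n)}$. Then $$\mathbb P\left(k_{\tau_n(\alpha)}(Y^{(n)})>k\right)\le\alpha .$$
   Context: $\mathcal L^\infty$ is the space of Lebesgue-measurable essentially bounded functions $[0,1]\to\mathbb R$ (genuine functions, not equivalence classes). With $t^-(\delta)=\max(0,t-\delta)$, $t^+(\delta)=\min(1,t+\delta)$, let $\mathcal L$ be the set of $f\in\mathcal L^\infty$ with $f(t)=\lim_{\epsilon\to0}\inf_{0<\delta<\epsilon}\frac{1}{t^+(\delta)-t^-(\delta)}\int_{t^-(\delta)}^{t^+(\delta)}f(s)\,ds$ for all $t\in[0,1]$ (each a.e.-class in $\mathcal L^\infty$ has exactly one representative in $\mathcal L$). The Kolmogorov distance is $d_K(f,g)=\sup_{x\in[0,1]}\left|\int_0^x (f(s)-g(s))\,ds\right|$. Number of modes: for $g:[0,1]\to\mathbb R$ and a partition $P$: $0=t_0<\dots<t_{N}=1$, let $M(g,P)$ be the number of indices $0<i<N$ with $\max(g(t_{i-1}),g(t_{i+1}))<g(t_i)$, and let $M(g)=\sup_P M(g,P)$ over all finite partitions.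 For $n\ge1$ let $PC_n$ be the set of $g\in\mathcal L$ that are constant on each open interval $\left(\frac{i-1}{n},\frac in\right)$, $i=1,\dots,n$. Let $X^{(n)}_j=\{g\in PC_n: M(g)\le j\}$, and for $g\in PC_n$ let $s_j(g)=\inf_{h\in X_j^{(n)}}d_K(g,h)$, $j\in\mathbb N_0$, and $s_{-1}(g)=\infty$. Let $f^{(n)}\in PC_n$ be the function with value $f\left(\frac{i-1}{n}\right)$ on $\left(\frac{i-1}{n},\frac in\right)$, and $Y^{(n)}\in PC_n$ the (random) function with value $Y_i$ on $\left(\frac{i-1}{n},\frac in\right)$, $i=1,\dots,n$. For $\epsilon>0$ and $g\in PC_n$: $k_\epsilon(g)=\max\{j\in\mathbb N_0: s_{j-1}(g)\ge\epsilon\}$. The threshold is $\tau_n(\alpha)=\frac1n\left(\sqrt{\log(\alpha/2)\left(\log(\alpha/2)\kappa^2-2nv\right)}-\kappa\log(\alpha/2)\right)$. *)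

(* Defs.v *)
From HB Require Import structures.
From mathcomp Require Import all_boot all_order all_algebra.
From mathcomp Require Import all_classical all_reals all_analysis.
From mathcomp Require Import measurable_realfun lra.

Set Implicit Arguments.
Unset Strict Implicit.
Unset Printing Implicit Defensive.

Import Order.TTheory GRing.Theory Num.Theory.
Import numFieldNormedType.Exports.

Local Open Scope classical_set_scope.
Local Open Scope ring_scope.

(* A function on [0, 1] is represented by a function R -> R; every notion     *)
(* below depends only on its values on [0, 1].                                *)

(* R equipped with the sigma-algebra of Lebesgue-measurable sets, i.e. the    *)
(* domain of the complete measure completed_lebesgue_measure.                 *)
Notation lebesgueType R := (caratheodory_type (@wlength R idfun)^*%mu).
Notation leb := (@completed_lebesgue_measure _).

Section FunctionClasses.
Context {R : realType}.
Implicit Types (f g : R -> R) (t x : R) (n : nat).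

Definition Linfty : set (R -> R) := [set f |
  measurable_fun (`[0, 1] : set (lebesgueType R)) (f : lebesgueType R -> R) /\
  exists C : R, {ae leb, forall s : R, s \in `[0, 1] -> `|f s| <= C}].

Definition tminus t (delta : R) : R := Num.max 0 (t - delta).
Definition tplus t (delta : R) : R := Num.min 1 (t + delta).

Definition avg f t (delta : R) : R :=
  (tplus t delta - tminus t delta)^-1 *
  \int[leb]_(s in `[tminus t delta, tplus t delta]) f s.

(* The infimum is monotone in epsilon, so the limit exists in \bar R.         *)
Definition lower_avg f t : \bar R :=
  lim (ereal_inf [set (avg f t delta)%:E | delta in `]0, epsilon[ ]
       @[epsilon --> 0^'+]).

Definition calL : set (R -> R) := [set f |
  Linfty f /\ forall t, t \in `[0, 1] -> (f t)%:E = lower_avg f t].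

Definition dK f g : \bar R :=
  ereal_sup [set `|\int[leb]_(s in `[0, x]) (f s - g s)|%:E | x in `[0, 1] ].

Definition is_partition (N : nat) (t : nat -> R) : Prop :=
  [/\ t 0%N = 0, t N = 1 & forall i, (i < N)%N -> t i < t i.+1].

Definition modes_on g (N : nat) (t : nat -> R) : nat :=
  #|[pred i : 'I_N | (0 < i)%N
                    && (Num.max (g (t i.-1)) (g (t i.+1)) < g (t i))]|.

Definition modes g : \bar R :=
  ereal_sup [set y | exists (N : nat) (t : nat -> R),
    is_partition N t /\ y = (modes_on g N t)%:R%:E].

(* The i-th interval, with i counted from 0.                                  *)
Definition cell n (i : nat) : interval R := `]i%:R / n%:R, i.+1%:R / n%:R[.

Definition PC n : set (R -> R) := [set g | calL g /\
  forall i : 'I_n, exists c : R, forall t, t \in cell n i -> g t = c].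

Definition Xmodes n (j : nat) : set (R -> R) :=
  [set g | PC n g /\ (modes g <= j%:R%:E)%E].

Definition sdist n g (j : nat) : \bar R :=
  ereal_inf [set dK g h | h in Xmodes n j].

Definition sdist_pred n g (j : nat) : \bar R :=
  if j is j'.+1 then sdist n g j' else +oo%E.

(* The maximum of {j | epsilon <= s_(j-1)(g)}, which exists whenever          *)
(* 0 < epsilon and g is in PC n.                                              *)
Definition keps n (epsilon : R) g : nat :=
  xget 0%N [set j : nat | (epsilon%:E <= sdist_pred n g j)%E /\
    forall j' : nat, (epsilon%:E <= sdist_pred n g j')%E -> (j' <= j)%N].

(* The element of PC n with value y i on the i-th cell. A function in calL is *)
(* determined by its a.e.-class, so the values at the grid points are those   *)
(* given by lower_avg.                                                        *)
Definition pc_raw n (y : 'I_n -> R) : R -> R :=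
  fun t => \sum_(i < n) y i * \1_[set` cell n i] t.

Definition pc_fun n (y : 'I_n -> R) : R -> R :=
  fun t => fine (lower_avg (pc_raw y) t).

Definition threshold (kappa v : R) n (alpha : R) : R :=
  n%:R^-1 *
  (Num.sqrt (ln (alpha / 2) * (ln (alpha / 2) * kappa ^+ 2 - 2 * n%:R * v))
   - kappa * ln (alpha / 2)).

End FunctionClasses.

Definition independent_family d (T : measurableType d) (R : realType)
    (P : probability T R) n (X : 'I_n -> {RV P >-> R}) : Prop :=
  forall (J : {set 'I_n}) (B : 'I_n -> set R),
    (forall i, measurable (B i)) ->
    P (\bigcap_(i in [set` J]) (X i @^-1` B i)) =
    (\prod_(i in J) P (X i @^-1` B i))%E.

Section PcFunProperties.
Context {R : realType}.
Implicit Types (f g : R -> R) (t : R).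
Local Notation Tl := (lebesgueType R).

Lemma leb_measurable (A : set R) : measurable A -> measurable (A : set Tl).
Proof. by move=> mA; apply: sub_caratheodory. Qed.

Lemma leb_lebesgue (A : set R) : leb (A : set Tl) = lebesgue_measure A.
Proof. by []. Qed.

Lemma leb_itv (a b : R) : a <= b -> leb (`[a, b] : set Tl) = (b - a)%:E.
Proof.
move=> ab; rewrite leb_lebesgue lebesgue_measure_itv/= lte_fin.
move: ab; rewrite le_eqVlt => /predU1P[->|->]; last by rewrite EFinB.
by rewrite ltxx subrr.
Qed.

Context (n : nat) (y : 'I_n -> R) (n0 : (0 < n)%N).
Let C : R := \sum_(i < n) `|y i|.

Lemma pc_raw_le t : `|pc_raw y t| <= C.
Proof.
rewrite /pc_raw (le_trans (ler_norm_sum _ _ _))// ler_sum// => i _.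
by rewrite normrM ler_piMr// indicE; case: (_ \in _); rewrite /= ?normr1 ?normr0.
Qed.

Lemma measurable_pc_raw (D : set R) : measurable_fun (D : set Tl) (pc_raw y : Tl -> R).
Proof.
apply: measurable_sum => i; apply: measurable_funM => //.
by apply: measurable_indic; apply: leb_measurable; exact: measurable_itv.
Qed.

Lemma tminus_tplus (t d : R) : t \in `[0, 1] -> 0 < d ->
  [/\ 0 <= tminus t d, tplus t d <= 1 & tminus t d < tplus t d].
Proof.
rewrite in_itv/= /tminus /tplus => /andP[t0 t1] d0; split.
- by rewrite le_max lexx.
- by rewrite ge_min lexx.
- rewrite gt_max !lt_min; apply/andP; split; apply/andP; split; lra.
Qed.

Lemma integrable_itv_le f (a b : R) : measurable_fun (`[a, b] : set Tl) (f : Tl -> R) -> a <= b ->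
  (forall t, `|f t| <= C) -> leb.-integrable (`[a, b] : set Tl) (EFin \o f).
Proof.
move=> mf ab fC; apply: measurable_bounded_integrable => //.
- by apply: leb_measurable; exact: measurable_itv.
- apply: (@le_lt_trans _ _ (b - a)%:E); last exact: ltry.
  by rewrite le_eqVlt; apply/orP; left; apply/eqP; exact: leb_itv.
- exists C; split; first exact: num_real.
  by move=> x Cx s _ /=; apply: le_trans (fC s) _; exact: ltW.
Qed.

Lemma avg_pc_raw_le t d : t \in `[0, 1] -> 0 < d -> `|avg (pc_raw y) t d| <= C.
Proof.
move=> ti d0; have [a0 b1 ab] := tminus_tplus ti d0.
set a := tminus t d in a0 ab *; set b := tplus t d in b1 ab *.
rewrite /avg -/a -/b normrM [`|_^-1|]ger0_norm ?invr_ge0 ?subr_ge0 ?(ltW ab)// ler_pdivrMl ?subr_gt0//.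
have mI : measurable (`[a, b] : set Tl) by apply: leb_measurable; exact: measurable_itv.
have iR := integrable_itv_le (@measurable_pc_raw `[a, b]) (ltW ab) pc_raw_le.
rewrite (le_trans (le_normr_Rintegral mI iR))//.
have -> : (b - a) * C = \int[leb]_(s in (`[a, b] : set Tl)) C.
  by rewrite Rintegral_cst// mulrC; congr (_ * _); exact: (esym (congr1 fine (leb_itv (ltW ab)))).
apply: le_Rintegral => //.
- apply: (@integrable_itv_le (Num.norm \o pc_raw y)) (ltW ab) _ => [|s].
    by apply: measurableT_comp => //; exact: measurable_pc_raw.
  by rewrite /= normr_id; exact: pc_raw_le.
- apply: (@integrable_itv_le (cst C)) (ltW ab) _ => // s /=.
  by rewrite ger0_norm// sumr_ge0.
- by move=> s _; exact: pc_raw_le.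
Qed.

Lemma lower_avgE f t : lower_avg f t =
  ereal_sup ((fun epsilon : R => ereal_inf [set (avg f t delta)%:E | delta in `]0, epsilon[ ])
    @` `]0, 1[).
Proof.
apply: cvg_lim => //.
apply: (@nonincreasing_at_right_cvge R _ 0 (BLeft 1)); first by rewrite bnd_simp.
move=> u v uI vI uv; apply: ereal_inf_le_tmp => _ [d /= + <-]; rewrite !in_itv/= => /andP[d0 dlt].
by exists d => //; rewrite in_itv/= d0 (lt_le_trans dlt).
Qed.

Lemma lower_avg_pc_raw_le t : t \in `[0, 1] ->
  (((- C)%:E <= lower_avg (pc_raw y) t) && (lower_avg (pc_raw y) t <= C%:E))%E.
Proof.
move=> ti; rewrite lower_avgE; apply/andP; split.
  apply: (@le_trans _ _ (ereal_inf [set (avg (pc_raw y) t delta)%:E | delta in `]0, 2^-1[ ])); last first.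
    by apply: ereal_sup_ubound; exists 2^-1 => //=; rewrite in_itv/=; lra.
  apply: le_ereal_inf_tmp => _ [d /= + <-]; rewrite in_itv/= => /andP[d0 _].
  by rewrite lee_fin; have := avg_pc_raw_le ti d0; rewrite ler_norml => /andP[].
apply: ge_ereal_sup => _ [e /= + <-]; rewrite in_itv/= => /andP[e0 _].
apply: (@le_trans _ _ (avg (pc_raw y) t (e / 2))%:E).
  by apply: ereal_inf_lbound; exists (e / 2) => //=; rewrite in_itv/=; lra.
by rewrite lee_fin; have := avg_pc_raw_le ti (divr_gt0 e0 (ltr0Sn _ 1)); rewrite ler_norml => /andP[].
Qed.

Lemma pc_natr_gt0 : 0 < n%:R :> R. Proof. by rewrite ltr0n. Qed.

Lemma cell_disj (i j : 'I_n) (t : R) : t \in cell n i -> t \in cell n j -> i = j.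
Proof.
rewrite !in_itv/= !ltr_pdivrMr ?pc_natr_gt0// !ltr_pdivlMr ?pc_natr_gt0// => /andP[a b] /andP[c e].
apply/val_inj/eqP; rewrite eqn_leq -ltnS -[(j <= i)%N]ltnS.
by rewrite -(ltr_nat R) (lt_trans a e) -(ltr_nat R) (lt_trans c b).
Qed.

Lemma pc_raw_cell (i : 'I_n) t : t \in cell n i -> pc_raw y t = y i.
Proof.
move=> ti; rewrite /pc_raw (bigD1 i)//= big1 ?addr0.
  by rewrite indicE mem_set// mulr1.
move=> j ji; rewrite indicE memNset ?mulr0// => /= tj.
by move: ji; rewrite (cell_disj ti tj) eqxx.
Qed.

Lemma cell01 (i : 'I_n) t : t \in cell n i -> 0 < t < 1.
Proof.
rewrite in_itv/= => /andP[a b]; apply/andP; split.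
  by apply: le_lt_trans a; rewrite divr_ge0.
apply: (lt_le_trans b); rewrite ler_pdivrMr ?pc_natr_gt0// mul1r ler_nat; exact: ltn_ord.
Qed.

Lemma lower_avg_cell (i : 'I_n) t : t \in cell n i -> lower_avg (pc_raw y) t = (y i)%:E.
Proof.
move=> ti; have /andP[t0 t1] := cell01 ti.
have t01 : t \in `[0, 1] by rewrite in_itv/= !ltW.
apply: lim_near_cst => //.
have := ti; rewrite in_itv/= => /andP[a b].
near=> e.
have He d : d \in `]0, e[ -> avg (pc_raw y) t d = y i.
  rewrite in_itv/= => /andP[d0 de].
  have [_ _ lt] := tminus_tplus t01 d0.
  rewrite /avg (_ : \int[leb]_(s in _) _ = \int[leb]_(s in (`[tminus t d, tplus t d] : set Tl)) (y i)).
    rewrite Rintegral_cst; last by apply: leb_measurable; exact: measurable_itv.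
    rewrite (_ : fine _ = tplus t d - tminus t d) 1?mulrCA ?mulVf ?mulr1//.
      by rewrite subr_eq0 gt_eqF.
    exact: (congr1 fine (leb_itv (ltW lt))).
  apply: eq_Rintegral => s /set_mem/=; rewrite in_itv/= => /andP[s1 s2].
  apply: pc_raw_cell; rewrite in_itv/=; apply/andP; split.
    apply: lt_le_trans s1; rewrite lt_max; apply/orP; right.
    rewrite ltrBrDl -ltrBrDr; apply: (lt_trans de); near: e; apply: nbhs_right_lt.
    by rewrite subr_gt0.
  apply: (le_lt_trans s2); rewrite gt_min; apply/orP; right.
  rewrite -ltrBrDl; apply: (lt_trans de); near: e; apply: nbhs_right_lt.
  by rewrite subr_gt0.
rewrite (_ : [set _ | _ in _] = [set (y i)%:E]) ?ereal_inf1//.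
apply/seteqP; split => [_ [d /= dI <-]|_ ->] /=; first by rewrite He.
have e0 : 0 < e by near: e; exact: nbhs_right_gt.
exists (e / 2); first by rewrite /= in_itv/=; lra.
by rewrite He// in_itv/=; lra.
Unshelve. all: by end_near. Qed.

Lemma pc_fun_cell (i : 'I_n) t : t \in cell n i -> pc_fun y t = y i.
Proof. by move=> ti; rewrite /pc_fun (lower_avg_cell ti). Qed.

Lemma grid_or_cell t : t \in `[0, 1] ->
  (exists i : 'I_n, t \in cell n i) \/ (exists j : 'I_n.+1, t = j%:R / n%:R).
Proof.
rewrite in_itv/= => /andP[t0 t1].
have nt0 : 0 <= t * n%:R by rewrite mulr_ge0.
have /andP[] := truncn_itv nt0; set j := Num.truncn _ => j1 j2.
have jn : (j < n.+1)%N.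
  rewrite ltnS -(ler_nat R) (le_trans j1)// -[leRHS]mul1r ler_wpM2r//.
move: j1; rewrite le_eqVlt => /predU1P[E|j1].
  by right; exists (Ordinal jn); rewrite /= E mulfK// gt_eqF// pc_natr_gt0.
have jn' : (j < n)%N.
  by rewrite -(ltr_nat R) (lt_le_trans j1)// -[leRHS]mul1r ler_wpM2r.
left; exists (Ordinal jn'); rewrite in_itv/= ltr_pdivrMr ?pc_natr_gt0// j1/=.
by rewrite ltr_pdivlMr ?pc_natr_gt0.
Qed.

Let h t : R := pc_raw y t + \sum_(j < n.+1)
  (pc_fun y (j%:R / n%:R) - pc_raw y (j%:R / n%:R)) * \1_[set j%:R / n%:R] t.

Lemma pc_fun_h t : t \in `[0, 1] -> pc_fun y t = h t.
Proof.
move=> /grid_or_cell[[i ti]|[j ->]]; rewrite /h.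
  rewrite (pc_fun_cell ti) (pc_raw_cell ti) big1 ?addr0// => j _.
  rewrite indicE memNset ?mulr0//= => tj; move: ti; rewrite tj in_itv/=.
  rewrite !ltr_pM2r ?invr_gt0 ?pc_natr_gt0// !ltr_nat ltnS => /andP[a b].
  by move: (leq_trans a b); rewrite ltnn.
rewrite (bigD1 j)//= big1 ?addr0.
  by rewrite indicE mem_set// mulr1 addrC subrK.
move=> k kj; rewrite indicE memNset ?mulr0//= => /(mulIf _) H.
move: kj; rewrite -(inj_eq val_inj)/= -(eqr_nat R) H ?eqxx//.
by rewrite invr_eq0 gt_eqF// pc_natr_gt0.
Qed.

Lemma measurable_pc_h (D : set R) : measurable_fun (D : set Tl) (h : Tl -> R).
Proof.
apply: measurable_funD; first exact: measurable_pc_raw.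
apply: measurable_sum => j; apply: measurable_funM => //.
by apply: measurable_indic; apply: leb_measurable; exact: measurable_set1.
Qed.

Lemma measurable_pc_fun (a b : R) : 0 <= a -> b <= 1 ->
  measurable_fun (`[a, b] : set Tl) (pc_fun y : Tl -> R).
Proof.
move=> a0 b1; apply: (eq_measurable_fun (h : Tl -> R)) (@measurable_pc_h _) => s /set_mem /=.
rewrite in_itv/= => /andP[s1 s2]; rewrite pc_fun_h// in_itv/=.
by rewrite (le_trans a0 s1) (le_trans s2 b1).
Qed.

Lemma ae_pc_fun : {ae leb, forall s : R, s \in `[0, 1] -> pc_fun y s = pc_raw y s}.
Proof.
pose N := \big[setU/set0]_(j < n.+1) [set j%:R / n%:R : R].
have mN : measurable (N : set R) by apply: bigsetU_measurable => j _; exact: measurable_set1.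
exists (N : set Tl); split.
- exact: leb_measurable.
- rewrite leb_lebesgue; apply: countable_lebesgue_measure0.
  rewrite /N -(bigcup_mkord n.+1 (fun j => [set j%:R / n%:R : R])).
  by apply: bigcup_countable => // j _; exact: countable1.
- move=> s /= /not_implyP[s01 ne].
  have [[i si]|[j E]] := grid_or_cell s01.
    by exfalso; apply: ne; rewrite (pc_fun_cell si) (pc_raw_cell si).
  rewrite /N -(bigcup_mkord n.+1 (fun j => [set j%:R / n%:R : R])); exists j => //=; exact: ltn_ord.
Qed.

Lemma avg_pc t d : t \in `[0, 1] -> 0 < d -> avg (pc_fun y) t d = avg (pc_raw y) t d.
Proof.
move=> t01 d0; have [a0 b1 ab] := tminus_tplus t01 d0; rewrite /avg; congr (_ * _).
congr fine; apply: ae_eq_integral.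
- by apply: leb_measurable; exact: measurable_itv.
- by apply/measurable_EFinP; exact: measurable_pc_fun.
- by apply/measurable_EFinP; exact: measurable_pc_raw.
- have [N [mN N0 sN]] := ae_pc_fun; exists N; split => // s /= /not_implyP[sI ne].
  apply: sN => /= H; apply: ne; rewrite H//.
  by move: sI; rewrite !in_itv/= => /andP[u v]; rewrite (le_trans a0 u) (le_trans v b1).
Qed.

(* For n > 0, pc_fun y is indeed in PC n, with value y i on the i-th cell.     *)
Lemma pc_funP : PC n (pc_fun y) /\
  forall (i : 'I_n) (t : R), t \in cell n i -> pc_fun y t = y i.
Proof.
split; last by move=> i t; exact: pc_fun_cell.
split; last by move=> i; exists (y i) => t; exact: pc_fun_cell.
split.
  split; first exact: measurable_pc_fun.
  exists C; have [N [mN N0 sN]] := ae_pc_fun; exists N; split => // s /= ne.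
  by apply: sN => /= H; apply: ne => s01; rewrite H//; exact: pc_raw_le.
move=> t t01; have /andP[l u] := lower_avg_pc_raw_le t01.
have -> : lower_avg (pc_fun y) t = lower_avg (pc_raw y) t.
  rewrite !lower_avgE; congr ereal_sup; apply: eq_imagel => e _.
  congr ereal_inf; apply: eq_imagel => d /=; rewrite in_itv/= => /andP[d0 _].
  by rewrite avg_pc.
rewrite /pc_fun fineK// fin_numE; apply/andP; split; apply/eqP => E.
  by move: l; rewrite E.
by move: u; rewrite E.
Qed.
End PcFunProperties.

(* Main.v *)
(* If k < k_tau(Y), then tau <= s_k(Y) <= d_K(Y, f), the last step because f has
   at most k modes. The integral from 0 to x of Y - f is a combination of the
   noise values with nonnegative weights that are nonincreasing in the index and
   at most 1/n, so by summation by parts n d_K(Y, f) is at most the largest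
   |e_1 + ... + e_j|. This maximum is controlled by Bernstein's inequality in its
   maximal form, obtained from the exponential moments of the stopped sums; the
   threshold is the solution of x^2 = 2 log(2/alpha) (n v + kappa x) with
   x = n tau, for which the two-sided bound is exactly alpha. *)
Require Import Defs.
From HB Require Import structures.
From mathcomp Require Import all_boot all_order all_algebra.
From mathcomp Require Import all_classical all_reals all_analysis.
From mathcomp Require Import measurable_realfun ring lra.

Import Order.TTheory GRing.Theory Num.Theory.
Import numFieldNormedType.Exports.

Local Open Scope classical_set_scope.
Local Open Scope ring_scope.

(** * Independence and stopped sums *)

Section independent_pair.
Context {d} {T : measurableType d} {R : realType} (P : probability T R).
Local Open Scope ereal_scope.

(** As functions of [C], both sides are finite measures on the plane. They agree on measurable
    rectangles, a pi-system that generates the sigma-algebra, hence everywhere. *)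
Lemma independent_pair_event (X Y : {RV P >-> R}) (E : set T) :
  measurable E ->
  (forall A B, measurable A -> measurable B ->
    P (X @^-1` A `&` Y @^-1` B `&` E) = P (X @^-1` A `&` Y @^-1` B) * P E) ->
  forall C : set (R * R), measurable C ->
  P ([set w | C (X w, Y w)] `&` E) = P [set w | C (X w, Y w)] * P E.
Proof.
move=> mE H C mC.
have mXY : measurable_fun setT (fun w => (X w, Y w)).
  by apply/measurable_fun_pairP; split => /=; exact: measurable_funP.
pose XY : {mfun T >-> (R * R)%type} := HB.pack (fun w => (X w, Y w))
  (isMeasurableFun.Build _ _ _ _ _ mXY).
have PE : P E \is a fin_num by exact: fin_num_measure.
pose c : {nonneg R} := NngNum (fine_ge0 (measure_ge0 P E)).
pose m1 : {measure set (R * R) -> \bar R} := pushforward (mrestr P mE) XY.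
pose m2 : {measure set (R * R) -> \bar R} := mscale c (pushforward P XY).
suff : m1 mXY C = m2 mXY C.
  by rewrite /m1 /m2 /= /mscale /pushforward /mrestr /= /c /= fineK// muleC.
pose G : set (set (R * R)) := [set A `*` B | A in measurable & B in measurable].
apply: (measure_unique G (fun=> setT)) => //.
- by rewrite measurable_prod_measurableType.
- move=> _ _ [A1 mA1 [B1 mB1 <-]] [A2 mA2 [B2 mB2 <-]].
  rewrite -setXI; exists (A1 `&` A2); first exact: measurableI.
  by exists (B1 `&` B2) => //; exact: measurableI.
- by move=> i; exists setT => //; exists setT => //; rewrite setXTT.
- by rewrite bigcup_const//; exists 0%N.
- move=> _ [A mA [B mB <-]].
  by rewrite /m1 /m2 /= /mscale /pushforward /mrestr /= /c /= fineK// muleC -H.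
- move=> _; rewrite /m1 /= /pushforward /mrestr /= preimage_setT setTI.
  by rewrite ltey_eq PE.
Qed.

(** The joint law is the product of the marginal laws, so Tonelli applies: the inner integral
    averages over [Y] while the value of [X] is held fixed. *)
Lemma independent_pair_integral (X Y : {RV P >-> R}) (h : R * R -> \bar R) :
  (forall A B, measurable A -> measurable B ->
    P (X @^-1` A `&` Y @^-1` B) = P (X @^-1` A) * P (Y @^-1` B)) ->
  measurable_fun setT h -> (forall z, 0 <= h z) ->
  \int[P]_w h (X w, Y w) = \int[P]_w \int[P]_w' h (X w, Y w').
Proof.
move=> H mh h0.
have mXY : measurable_fun setT (fun w => (X w, Y w)).
  by apply/measurable_fun_pairP; split => /=; exact: measurable_funP.
pose XY : {mfun T >-> (R * R)%type} := HB.pack (fun w => (X w, Y w))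
  (isMeasurableFun.Build _ _ _ _ _ mXY).
transitivity (\int[distribution P XY]_z h z).
  by rewrite ge0_integral_pushforward.
transitivity (\int[distribution P X \x distribution P Y]_z h z).
  apply: eq_measure_integral => C mC _; apply/esym.
  by apply: product_measure_unique => // A B mA mB; rewrite -[RHS]H.
rewrite fubini_tonelli1// [fubini_F _ _]/fubini_F ge0_integral_pushforward//.
- by apply: eq_integral => w _ /=; rewrite ge0_integral_pushforward//; exact: measurableT_comp.
- exact: measurable_fun_fubini_tonelli_F.
- by move=> x _; exact: integral_ge0.
Qed.

End independent_pair.

(* The partial sums of e, frozen from the first time they reach x: this turns
   the event that some partial sum reaches x into a tail event of one random
   variable. *)
Fixpoint stopped_sum {R : realType} (x : R) (e : nat -> R) (n : nat) : R :=
  if n is m.+1 then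
    let s := stopped_sum x e m in if x <= s then s else s + e m
  else 0.

(** A frozen value stays at or above [x], so ending below [x] means that freezing never happened. *)
Lemma stopped_sum_lt {R : realType} (x : R) (e : nat -> R) (n : nat) :
  stopped_sum x e n < x ->
  stopped_sum x e n = \sum_(i < n) e i /\
  forall j, (j <= n)%N -> \sum_(i < j) e i < x.
Proof.
elim: n => [|n IH] /=.
  move=> x0; split; first by rewrite big_ord0.
  by move=> j; rewrite leqn0 => /eqP ->; rewrite big_ord0.
case: ifPn => [xs /(le_lt_trans xs)|]; first by rewrite ltxx.
rewrite -ltNge => /IH[-> H] lt; split; first by rewrite big_ord_recr.
move=> j; rewrite leq_eqVlt => /predU1P[->|/H//].
by rewrite big_ord_recr.
Qed.

(** * Exponential maximal inequality for stopped sums *)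

Section maximal_inequality.
Context {d} {T : measurableType d} {R : realType} (P : probability T R).
Local Open Scope ereal_scope.
Variables (e : nat -> {RV P >-> R}) (n : nat).
Hypothesis ind : forall B : nat -> set R, (forall i, measurable (B i)) ->
  P (\bigcap_(i in `I_n) (e i @^-1` B i)) = \prod_(i < n) P (e i @^-1` B i).

Let W (x : R) (j : nat) (w : T) : R := stopped_sum x (e ^~ w) j.

Lemma measurable_stopped_sum (x : R) (j : nat) :
  measurable_fun setT (fun w => stopped_sum x (e ^~ w) j).
Proof.
elim: j => [|j IH] /=; first exact: measurable_cst.
apply: measurable_fun_ifT => //; first exact: measurable_fun_ler.
exact: measurable_funD.
Qed.

HB.instance Definition _ (x : R) (j : nat) :=
  isMeasurableFun.Build _ _ _ _ (W x j) (measurable_stopped_sum x j).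

Let E (j : nat) (B : nat -> set R) : set T :=
  \bigcap_(i in [set i | (j <= i < n)%N]) (e i @^-1` B i).

Let mE j B : (forall i, measurable (B i)) -> measurable (E j B).
Proof.
move=> mB; rewrite /E; apply: fin_bigcap_measurable.
  by apply: (sub_finite_set _ (finite_II n)) => i /= /andP[].
by move=> i _; exact: measurable_funPTI.
Qed.

Let PE j B : (forall i, measurable (B i)) ->
  P (E j B) = \prod_(j <= i < n) P (e i @^-1` B i).
Proof.
move=> mB.
(* Coordinates below [j] are left unconstrained, so that [ind] applies to all [n] factors and the
   extra ones equal 1. *)
pose B' i := if (j <= i)%N then B i else setT.
have -> : E j B = \bigcap_(i in `I_n) (e i @^-1` B' i).
  apply/seteqP; split => w /= H i.
    by rewrite /B' /=; case: ifPn => // ji ilt; apply: H; rewrite /= ji.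
  by move=> /= /andP[ji ilt]; have := H i ilt; rewrite /B' /= ji.
rewrite ind; last by move=> i; rewrite /B'; case: ifP.
rewrite -(big_mkord xpredT (fun i => P (e i @^-1` B' i))).
rewrite (@big_nat_widenl _ _ _ j 0%N n)//= [RHS]big_mkcond /=.
apply: eq_bigr => i _; rewrite /B'; case: ifP => //.
by rewrite preimage_setT probability_setT.
Qed.

Let PES j B : (forall i, measurable (B i)) -> (j < n)%N ->
  P (E j B) = P (e j @^-1` B j) * P (E j.+1 B).
Proof. by move=> mB jn; rewrite !PE// big_ltn. Qed.

Let ES j B : (j < n)%N -> E j B = e j @^-1` B j `&` E j.+1 B.
Proof.
move=> jn; apply/seteqP; split => w.
  by move=> H; split => [|i /= /andP[ji ilt]]; apply: H; rewrite /= ?leqnn// ilt andbT ltnW.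
move=> [Hj H] i /= /andP[]; rewrite leq_eqVlt => /predU1P[<-//|ji ilt].
by apply: H; rewrite /= ji.
Qed.

Let step (x : R) (z : R * R) : R := if (x <= z.1)%R then z.1 else (z.1 + z.2)%R.

Let mstep x : measurable_fun setT (step x).
Proof.
apply: measurable_fun_ifT => //; first exact: measurable_fun_ler.
exact: measurable_funD.
Qed.

(* Induction on j: the pair (W j, e j) is independent of the later e i because
   this holds on rectangles, and W j.+1 is a function of that pair. *)
Lemma stopped_sum_indep x j : (j <= n)%N ->
  forall A B, measurable A -> (forall i, measurable (B i)) ->
  P (W x j @^-1` A `&` E j B) = P (W x j @^-1` A) * P (E j B).
Proof.
elim: j => [_|j IH jn] A B mA mB.
  have [A0|A0] := pselect (A 0%R).
    rewrite (_ : W x 0 @^-1` A = setT) ?setTI ?probability_setT ?mul1e//.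
    by apply/seteqP; split.
  rewrite (_ : W x 0 @^-1` A = set0) ?set0I ?measure0 ?mul0e//.
  by apply/seteqP; split.
apply: (independent_pair_event P (W x j) (e j) (E j.+1 B) _ _ (step x @^-1` A)).
- exact: mE.
- move=> A1 A2 mA1 mA2.
  (* The induction hypothesis is used twice: [B1] constrains [e j] and the later variables, [B2]
     only [e j]. The second use turns the product of the two marginal probabilities back into that
     of the rectangle. *)
  pose B1 i := if i == j then A2 else B i.
  pose B2 i := if i == j then A2 else setT.
  have mB1 i : measurable (B1 i) by rewrite /B1; case: ifP.
  have mB2 i : measurable (B2 i) by rewrite /B2; case: ifP.
  have EB1 : E j.+1 B1 = E j.+1 B.
    apply: eq_bigcapr => i /= /andP[ji _].
    by rewrite /B1 gtn_eqF.
  have EB2 : E j.+1 B2 = setT.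
    apply/seteqP; split => // w _ i /= /andP[ji _].
    by rewrite /B2 gtn_eqF.
  rewrite -setIA; have := IH (ltnW jn) A1 B1 mA1 mB1.
  rewrite PES// ES// EB1 /B1 eqxx => ->.
  have := IH (ltnW jn) A1 B2 mA1 mB2.
  by rewrite PES// ES// EB2 /B2 eqxx probability_setT mule1 setIT => ->; rewrite muleA.
- by rewrite -[X in measurable X]setTI; exact: mstep.
Qed.

Lemma stopped_sum_indep_next x j : (j < n)%N ->
  forall A B, measurable A -> measurable B ->
  P (W x j @^-1` A `&` e j @^-1` B) = P (W x j @^-1` A) * P (e j @^-1` B).
Proof.
move=> jn A B mA mB.
pose B2 i := if i == j then B else setT.
have mB2 i : measurable (B2 i) by rewrite /B2; case: ifP.
have EB2 : E j.+1 B2 = setT.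
  apply/seteqP; split => // w _ i /= /andP[ji _].
  by rewrite /B2 gtn_eqF.
have := stopped_sum_indep x j (ltnW jn) A B2 mA mB2.
by rewrite PES// ES// EB2 /B2 eqxx probability_setT mule1 setIT.
Qed.

Variables (lam M : R).
Hypotheses (M1 : (1 <= M)%R)
  (eM : forall i, (i < n)%N -> \int[P]_w (expR (lam * e i w))%:E <= M%:E).

(** With [W x j] held fixed, one more step costs at most a factor [M]: a frozen sum keeps its
    exponential moment and [1 <= M], while otherwise the factor coming from [e j] splits off by
    independence. *)
Lemma stopped_sum_mgf (x : R) j : (j <= n)%N ->
  \int[P]_w (expR (lam * W x j w))%:E <= (M ^+ j)%:E.
Proof.
elim: j => [_|j IH jn].
  under eq_integral do rewrite /W /= mulr0 expR0.
  by rewrite integral_cst//= probability_setT mul1e expr0.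
pose h (z : R * R) : \bar R := (expR (lam * step x z))%:E.
have mh : measurable_fun setT h.
  apply/measurable_EFinP; apply: measurableT_comp => //.
  exact: measurable_funM.
have mexp (X : T -> R) : measurable_fun setT X ->
    measurable_fun setT (fun w => (expR (lam * X w))%:E).
  move=> mX; apply/measurable_EFinP; apply: measurableT_comp => //.
  exact: measurable_funM.
change (\int[P]_w h (W x j w, e j w) <= (M ^+ j.+1)%:E).
rewrite (independent_pair_integral P (W x j) (e j) h)//; last 2 first.
- by move=> A B; exact: stopped_sum_indep_next.
- by move=> z; rewrite lee_fin expR_ge0.
apply: (@le_trans _ _ (\int[P]_w ((expR (lam * W x j w))%:E * M%:E))).
  apply: ge0_le_integral => //.
  - by move=> w _; apply: integral_ge0 => ? _; rewrite lee_fin expR_ge0.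
  - apply: (@measurable_fun_fubini_tonelli_F _ _ T T R P
      (fun z : T * T => h (W x j z.1, e j z.2))) => //.
      apply: (measurableT_comp mh); apply/measurable_fun_pairP; split => /=.
        by apply: (measurableT_comp (measurable_funP (W x j))).
      exact: (measurableT_comp (measurable_funP (e j))).
  - by move=> z; rewrite lee_fin expR_ge0.
  - apply/measurable_EFinP.
    apply: (measurable_funM (f := fun w => expR (lam * W x j w)) (g := fun=> M)) => //.
    exact/measurable_EFinP/mexp.
  - move=> w _; rewrite /h /step /=; case: (boolP (x <= W x j w)%R) => _.
      rewrite integral_cst//= probability_setT mule1 lee_fin.
      by rewrite ler_peMr// expR_ge0.
    under eq_integral do rewrite mulrDr expRD EFinM.
    rewrite ge0_integralZl//; last by apply: mexp.
    by rewrite lee_wpmul2l ?lee_fin ?expR_ge0// eM.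
rewrite ge0_integralZr//; last 2 first.
  by apply: mexp.
  by rewrite lee_fin (le_trans ler01).
by rewrite exprSr EFinM lee_wpmul2r ?lee_fin ?(le_trans ler01)// IH// ltnW.
Qed.

Hypothesis lam_gt0 : (0 < lam)%R.

(** Markov's inequality for the exponential of [lam] times the stopped sum. *)
Lemma stopped_sum_tail (x : R) :
  P [set w | (x <= stopped_sum x (e ^~ w) n)%R] <= (expR (- (lam * x)) * M ^+ n)%:E.
Proof.
rewrite expRN mulrC EFinM lee_pdivlMr ?expR_gt0//.
apply: le_trans (stopped_sum_mgf x n (leqnn n)).
set S := [set w | _].
have mS : measurable S.
  rewrite -[S]setTI; apply: measurable_fun_le => //; exact: measurable_stopped_sum.
rewrite muleC -integral_cst//.
have mexp : measurable_fun setT (fun w => (expR (lam * W x n w))%:E).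
  by apply/measurable_EFinP; apply: measurableT_comp => //; exact: measurable_funM.
apply: (@le_trans _ _ (\int[P]_(w in S) (expR (lam * W x n w))%:E)).
  apply: ge0_le_integral => //.
  - by move=> w _; rewrite lee_fin expR_ge0.
  - exact: (measurable_funS measurableT (@subsetT _ S)).
  - by move=> w Sw; rewrite lee_fin ler_expR ler_pM2l.
apply: ge0_subset_integral => //.
Qed.

End maximal_inequality.

(** * Bernstein's inequality *)

(** The exponential series without its first two terms, bounded termwise by absolute values. The sum
    lives in the extended reals, so that it can be integrated term by term. *)
Lemma expR_le_eseries {R : realType} (y : R) :
  ((expR y - 1 - y)%:E <=
    \sum_(m <oo) ((m.+2)`!%:R^-1 * `|y| ^+ m.+2)%:E)%E.
Proof.
set S := (X in (_ <= X)%E).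
have t0 m : (0 <= ((m.+2)`!%:R^-1 * `|y| ^+ m.+2)%:E)%E.
  by rewrite lee_fin mulr_ge0// exprn_ge0.
have : (0 <= S)%E by exact: nneseries_ge0.
case SE : S => [c| |//] c0; last by rewrite leey.
rewrite lee_fin lerBlDr lerBlDr; apply: limr_le; first exact: is_cvg_series_exp_coeff.
near=> k; have k2 : (2 <= k)%N by near: k; exact: nbhs_infty_ge.
rewrite -(subnKC k2) /series /= -[(2 + _)%N]/(k - 2).+2.
rewrite big_nat_recl// big_nat_recl// /exp_coeff /= expr0 expr1 !divr1.
rewrite [leRHS]addrC lerD2l [leRHS]addrC lerD2l.
rewrite -lee_fin -SE.
apply: le_trans (nneseries_lim_ge (k - 2) (fun m _ _ => t0 m)).
rewrite sumEFin lee_fin; apply: ler_sum => m _.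
by rewrite mulrC ler_wpM2l// -normrX ler_norm.
Unshelve. all: by end_near. Qed.

Section bernstein_mgf.
Context {d} {T : measurableType d} {R : realType} (P : probability T R).
Local Open Scope ereal_scope.
Variables (X : {RV P >-> R}) (kappa v lam : R).
Hypotheses (kappa_gt0 : (0 < kappa)%R) (v_gt0 : (0 < v)%R)
  (lamk : (`|lam| * kappa < 1)%R).
Hypothesis X0 : 'E_P[X] = 0.
Hypothesis Xm : forall m, (2 <= m)%N ->
  'E_P[fun w => (`|X w| ^+ m)%R] <= (v * (m`!)%:R * kappa ^+ (m - 2) / 2)%:E.

Let mXm m : measurable_fun setT (fun w => (`|X w| ^+ m)%R).
Proof.
by apply: (measurableT_comp (exprn_measurable m)); exact: measurableT_comp.
Qed.

Let intX : P.-integrable setT (EFin \o X).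
Proof.
have intX2 : P.-integrable setT (EFin \o (fun w => `|X w| ^+ 2)%R).
  apply/integrableP; split; first exact/measurable_EFinP.
  have := Xm 2 isT; rewrite unlock => /le_lt_trans/(_ (ltry _)); apply: le_lt_trans.
  apply: ge0_le_integral => //.
  - by apply: measurableT_comp => //; exact/measurable_EFinP.
  - exact/measurable_EFinP.
  - by move=> w _ /=; rewrite ger0_norm// exprn_ge0.
(* The second moment suffices because [|X|] is at most [1 + |X| ^ 2]. *)
have := integrableD measurableT (finite_measure_integrable_cst P 1%R measurableT) intX2.
apply: le_integrable => //; first exact/measurable_EFinP.
move=> w _ /=; rewrite lee_fin [leRHS]ger0_norm ?addr_ge0 ?exprn_ge0//.
nra.
Qed.

(** Since the mean is zero, the exponential moment is 1 plus the integral of [g]. The moment bounds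
    cancel the factorials and leave a geometric series of ratio [|lam| * kappa] with sum [c]; then
    [1 + c <= expR c]. *)
Lemma bernstein_mgf :
  \int[P]_w (expR (lam * X w))%:E <= (expR (v * `|lam| ^+ 2 / (2 * (1 - `|lam| * kappa))))%:E.
Proof.
set c := (v * `|lam| ^+ 2 / (2 * (1 - `|lam| * kappa)))%R.
pose g w := (expR (lam * X w) - 1 - lam * X w)%R.
have g0 w : (0 <= g w)%R by rewrite /g -addrA -opprD subr_ge0 expR_ge1Dx.
have mlX : measurable_fun setT (fun w => (lam * X w)%R) by exact: measurable_funM.
have mg : measurable_fun setT g.
  by apply: measurable_funB => //; apply: measurable_funB => //; exact: measurableT_comp.
have gc : \int[P]_w (g w)%:E <= c%:E.
  pose t m w : \bar R := ((m.+2)`!%:R^-1 * `|lam * X w| ^+ m.+2)%:E.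
  have mt m : measurable_fun setT (t m).
    apply/measurable_EFinP/measurable_funM => //.
    by apply: (measurableT_comp (exprn_measurable m.+2)); exact: measurableT_comp.
  have t0 m w : 0 <= t m w by rewrite lee_fin mulr_ge0// exprn_ge0.
  apply: (@le_trans _ _ (\int[P]_w \sum_(m <oo) t m w)).
    apply: ge0_le_integral => //.
    - by move=> w _; rewrite lee_fin.
    - exact/measurable_EFinP.
    - by apply: ge0_emeasurable_sum => // m _; exact: mt.
    - by move=> w _; exact: expR_le_eseries.
  rewrite integral_nneseries//.
  have tb m : \int[P]_w t m w <= (v * `|lam| ^+ 2 / 2 * (`|lam| * kappa) ^+ m)%:E.
    rewrite /t (eq_integral
      (fun w => (`|lam| ^+ m.+2 / (m.+2)`!%:R)%:E * (`|X w| ^+ m.+2)%:E)); last first.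
      move=> w _; rewrite -EFinM; congr EFin.
      by rewrite normrM exprMn; ring.
    rewrite ge0_integralZl_EFin//; last exact/measurable_EFinP.
    have := Xm m.+2 isT; rewrite unlock subSS subSS subn0 => Xm2.
    apply: (@le_trans _ _ ((`|lam| ^+ m.+2 / (m.+2)`!%:R)%:E *
      (v * (m.+2)`!%:R * kappa ^+ m / 2)%:E)).
      by rewrite lee_wpmul2l// lee_fin divr_ge0// exprn_ge0.
    rewrite -EFinM lee_fin le_eqVlt; apply/orP; left; apply/eqP.
    have f0 : (m.+2)`!%:R != 0%R :> R by rewrite pnatr_eq0 -lt0n fact_gt0.
    by rewrite exprMn -(addn2 m) exprD; field; rewrite addn2.
  apply: (@le_trans _ _ (\sum_(m <oo) (v * `|lam| ^+ 2 / 2 * (`|lam| * kappa) ^+ m)%:E)).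
    by apply: lee_nneseries => // m _ _; exact: integral_ge0.
  have lk0 : (0 <= `|lam| * kappa)%R by rewrite mulr_ge0// ltW.
  have vl0 : (0 <= v * `|lam| ^+ 2 / 2)%R by rewrite divr_ge0// mulr_ge0 ?sqr_ge0// ltW.
  apply: lime_le.
    by apply: is_cvg_nneseries => m _ _; rewrite lee_fin mulr_ge0// exprn_ge0.
  apply: nearW => k; rewrite sumEFin lee_fin -mulr_sumr.
  have -> : c = (v * `|lam| ^+ 2 / 2 * (1 - `|lam| * kappa)^-1)%R by rewrite /c invfM mulrA.
  rewrite ler_wpM2l// -[leRHS]mul1r ler_pdivlMr ?subr_gt0// big_mkord.
  (* The partial geometric sum times one minus its ratio is 1 minus a nonnegative power. *)
  by rewrite mulrC -[(1 - _)%R]opprB mulNr -subrX1 opprB gerBl exprn_ge0.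
have intg : P.-integrable setT (EFin \o g).
  apply/integrableP; split; first exact/measurable_EFinP.
  under eq_integral do rewrite /= ger0_norm//.
  exact: le_lt_trans gc (ltry _).
have intl : P.-integrable setT (fun w => (lam * X w)%:E).
  exact: (integrableZl measurableT _ intX).
have int1 := finite_measure_integrable_cst P 1%R measurableT.
have -> : \int[P]_w (expR (lam * X w))%:E = \int[P]_w ((g w)%:E + (1 + (lam * X w)%:E)).
  by apply: eq_integral => w _; rewrite -!EFinD; congr EFin; rewrite /g; ring.
rewrite integralD//; last exact: integrableD.
rewrite integralD// integral_cst//= probability_setT mul1e.
under [X in _ + (_ + X)]eq_integral do rewrite EFinM.
rewrite integralZl//.
have -> : \int[P]_w (X w)%:E = 0 by rewrite -expectation_def X0.
rewrite mule0 adde0 addeC.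
apply: (@le_trans _ _ (1 + c%:E)); first by rewrite leeD2l.
by rewrite -EFinD lee_fin expR_ge1Dx.
Qed.
End bernstein_mgf.

Section bernstein_maximal.
Context {d} {T : measurableType d} {R : realType} (P : probability T R).
Local Open Scope ereal_scope.
Variables (e : nat -> {RV P >-> R}) (n : nat) (kappa v : R).
Hypotheses (n_gt0 : (0 < n)%N) (kappa_gt0 : (0 < kappa)%R) (v_gt0 : (0 < v)%R).
Hypothesis ind : forall B : nat -> set R, (forall i, measurable (B i)) ->
  P (\bigcap_(i in `I_n) (e i @^-1` B i)) = \prod_(i < n) P (e i @^-1` B i).
Hypothesis mgf : forall i lam, (`|lam| * kappa < 1)%R ->
  \int[P]_w (expR (lam * e i w))%:E <=
    (expR (v * `|lam| ^+ 2 / (2 * (1 - `|lam| * kappa))))%:E.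

Lemma bernstein_stopped_sum (x : R) : (0 < x)%R ->
  P [set w | (x <= stopped_sum x (e ^~ w) n)%R] <=
    (expR (- (x ^+ 2 / (2 * (n%:R * v + kappa * x)))))%:E.
Proof.
move=> x0.
have nv0 : (0 < n%:R * v)%R by rewrite mulr_gt0// ltr0n.
have kx0 : (0 < kappa * x)%R by rewrite mulr_gt0.
set D := (n%:R * v + kappa * x)%R.
have D0 : (0 < D)%R by rewrite addr_gt0.
(* This choice gives [1 - lam * kappa = n v / D], so the total exponent [- lam x + n c] collapses to
   [- x ^ 2 / (2 D)]. *)
pose lam := (x / D)%R.
have lam0 : (0 < lam)%R by rewrite divr_gt0.
have lamk : (1 - lam * kappa = n%:R * v / D)%R.
  by rewrite /lam /D; field; rewrite gt_eqF.
have lamk1 : (`|lam| * kappa < 1)%R.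
  by rewrite gtr0_norm// -subr_gt0 lamk divr_gt0.
set c := (v * `|lam| ^+ 2 / (2 * (1 - `|lam| * kappa)))%R.
have c0 : (0 <= c)%R.
  rewrite /c gtr0_norm// lamk divr_ge0//; first by rewrite mulr_ge0 ?sqr_ge0// ltW.
  by rewrite mulr_ge0// divr_ge0// ltW.
apply: (le_trans (stopped_sum_tail P e n ind lam (expR c) _ _ lam0 x)).
- by rewrite -expR0 ler_expR.
- by move=> i _; exact: mgf.
- rewrite -expRM_natl -expRD lee_fin ler_expR le_eqVlt; apply/orP; left; apply/eqP.
  rewrite /c gtr0_norm// lamk /lam; field.
  by rewrite !gt_eqF// ltr0n.
Qed.

End bernstein_maximal.

Section bernstein_maximal_abs.
Context {d} {T : measurableType d} {R : realType} (P : probability T R).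
Local Open Scope ereal_scope.
Variables (e : nat -> {RV P >-> R}) (n : nat) (kappa v : R).
Hypotheses (n_gt0 : (0 < n)%N) (kappa_gt0 : (0 < kappa)%R) (v_gt0 : (0 < v)%R).
Hypothesis ind : forall B : nat -> set R, (forall i, measurable (B i)) ->
  P (\bigcap_(i in `I_n) (e i @^-1` B i)) = \prod_(i < n) P (e i @^-1` B i).
Hypothesis mean0 : forall i, 'E_P[e i] = 0.
Hypothesis moment : forall i m, (2 <= m)%N ->
  'E_P[fun w => (`|e i w| ^+ m)%R] <= (v * (m`!)%:R * kappa ^+ (m - 2) / 2)%:E.

(** A union bound over the stopped sums of [e] and of its negation [ne], which satisfies the same
    independence and moment estimates. *)
Lemma bernstein_maximal (x : R) (A : set T) : (0 < x)%R -> measurable A ->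
  (forall w, A w -> exists2 j, (j <= n)%N & (x <= `|\sum_(i < j) e i w|)%R) ->
  P A <= (2 * expR (- (x ^+ 2 / (2 * (n%:R * v + kappa * x)))))%:E.
Proof.
move=> x0 mA Ax.
have mne i : measurable_fun setT (fun w => - e i w)%R by exact: measurableT_comp.
pose ne i : {RV P >-> R} := HB.pack (fun w => - e i w)%R
  (isMeasurableFun.Build _ _ _ _ _ (mne i)).
have mgf i lam : (`|lam| * kappa < 1)%R ->
    \int[P]_w (expR (lam * e i w))%:E <=
      (expR (v * `|lam| ^+ 2 / (2 * (1 - `|lam| * kappa))))%:E.
  by move=> lamk; exact: bernstein_mgf (moment i).
have nmgf i lam : (`|lam| * kappa < 1)%R ->
    \int[P]_w (expR (lam * ne i w))%:E <=
      (expR (v * `|lam| ^+ 2 / (2 * (1 - `|lam| * kappa))))%:E.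
  move=> lamk; rewrite (eq_integral (fun w => (expR (- lam * e i w))%:E)).
    by rewrite -normrN; apply: mgf; rewrite normrN.
  by move=> w _; rewrite /ne /= mulrN mulNr.
have nind (B : nat -> set R) : (forall i, measurable (B i)) ->
    P (\bigcap_(i in `I_n) (ne i @^-1` B i)) = \prod_(i < n) P (ne i @^-1` B i).
  move=> mB; apply: (ind (fun i => -%R @^-1` B i)) => i.
  by rewrite -[X in measurable X]setTI; exact: oppr_measurable.
have mS (u : nat -> {RV P >-> R}) : measurable [set w | (x <= stopped_sum x (u ^~ w) n)%R].
  rewrite -[X in measurable X]setTI; apply: measurable_fun_le => //.
  exact: measurable_stopped_sum.
set S1 := [set w | (x <= stopped_sum x (e ^~ w) n)%R].
set S2 := [set w | (x <= stopped_sum x (ne ^~ w) n)%R].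
have AS : A `<=` S1 `|` S2.
  (* If both stopped sums end below [x], every partial sum lies strictly between [- x] and [x]. *)
  move=> w /Ax[j jn xj]; apply: contrapT => /not_orP[/negP + /negP].
  rewrite -!ltNge => /stopped_sum_lt[_ /(_ j jn) H1] /stopped_sum_lt[_ /(_ j jn) H2].
  move: xj; rewrite leNgt ltr_norml => /negP; apply; rewrite H1 andbT ltrNl.
  by rewrite -sumrN.
apply: (@le_trans _ _ (P (S1 `|` S2))).
  by apply: le_measure; rewrite ?inE//; apply: measurableU; exact: mS.
apply: le_trans (measureU2 _ (mS e) (mS ne)) _.
by rewrite mulrDl mul1r EFinD leeD// bernstein_stopped_sum.
Qed.

End bernstein_maximal_abs.

(** * Kolmogorov distances of step functions *)

Lemma abel_norm_le {R : realDomainType} (D l : nat -> R) (n : nat) (M : R) :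
  (forall i, 0 <= l i) -> (forall i, l i.+1 <= l i) ->
  (forall j, (j <= n)%N -> `|\sum_(i < j) D i| <= M) ->
  `|\sum_(i < n) D i * l i| <= M * l 0%N.
Proof.
move=> l0 ldec SM.
(* Summation by parts: with the boundary term removed, each step adds a partial sum times the
   nonnegative drop [l m - l m.+1], and the drops telescope. *)
have H m : (m <= n)%N ->
    `|\sum_(i < m) D i * l i - (\sum_(i < m) D i) * l m| <= M * (l 0%N - l m).
  elim: m => [_|m IH mn]; first by rewrite !big_ord0 mul0r !subrr mulr0 normr0.
  have -> : \sum_(i < m.+1) D i * l i - (\sum_(i < m.+1) D i) * l m.+1 =
      (\sum_(i < m) D i * l i - (\sum_(i < m) D i) * l m) +
      (\sum_(i < m.+1) D i) * (l m - l m.+1).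
    by rewrite !big_ord_recr /=; ring.
  have -> : M * (l 0%N - l m.+1) = M * (l 0%N - l m) + M * (l m - l m.+1) by ring.
  rewrite (le_trans (ler_normD _ _))// lerD ?IH ?(ltnW mn)//.
  by rewrite normrM (ger0_norm (x := l m - _)) ?subr_ge0// ler_wpM2r ?subr_ge0// SM.
have := H n (leqnn n); have := SM n (leqnn n).
rewrite -[\sum_(i < n) D i * l i](subrK ((\sum_(i < n) D i) * l n)) => Sn Hn.
rewrite addrK in Hn.
rewrite (le_trans (ler_normD _ _))// normrM (ger0_norm (l0 n)).
have -> : M * l 0%N = M * (l 0%N - l n) + M * l n by ring.
by rewrite lerD// ler_wpM2r.
Qed.

Section kolmogorov_distance.
Context {R : realType}.
Local Notation Tl := (lebesgueType R).
Implicit Types (f g h : R -> R) (x : R).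

Lemma measurable_itv_leb (a b : R) : measurable (`[a, b] : set Tl).
Proof. by apply: leb_measurable; exact: measurable_itv. Qed.

Lemma Linfty_integrable f x : Linfty f -> 0 <= x <= 1 ->
  leb.-integrable (`[0, x] : set Tl) (EFin \o f).
Proof.
move=> [mf [C aeC]] /andP[x0 x1].
have sub : `[0, x] `<=` (`[0, 1] : set R).
  by move=> s /=; rewrite !in_itv/= => /andP[-> /le_trans->].
have mfx : measurable_fun (`[0, x] : set Tl) (EFin \o f).
  by apply/measurable_EFinP; apply: measurable_funS mf => //; exact: measurable_itv_leb.
apply/integrableP; split => //.
have Cfin : (`|C|%:E * (x - 0)%:E < +oo)%E by rewrite -EFinM ltry.
apply: le_lt_trans Cfin; rewrite -(leb_itv x0).
apply: integral_le_bound => //; first exact: measurable_itv_leb.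
have [N [mN N0 sN]] := aeC; exists N; split => // s /= ne.
apply: sN => /= H; apply: ne => sI; rewrite lee_fin.
by rewrite (le_trans (H (sub _ sI)))// ler_norm.
Qed.

Lemma PC_Linfty n g : PC n g -> Linfty g.
Proof. by move=> [[]]. Qed.

Lemma dK_triangle f g h : Linfty f -> Linfty g -> Linfty h ->
  (dK f h <= dK f g + dK g h)%E.
Proof.
move=> Lf Lg Lh; apply: ge_ereal_sup => _ [x /= xI <-].
have x01 : 0 <= x <= 1 by move: xI; rewrite in_itv.
have If := Linfty_integrable _ _ Lf x01; have Ig := Linfty_integrable _ _ Lg x01.
have Ih := Linfty_integrable _ _ Lh x01; have mI := measurable_itv_leb 0 x.
rewrite RintegralB//.
pose I (u : R -> R) := \int[leb]_(s in (`[0, x] : set Tl)) u s.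
apply: (@le_trans _ _ (`|I f - I g|%:E + `|I g - I h|%:E)%E).
  by rewrite -EFinD lee_fin; exact: ler_distD.
apply: leeD; apply: ereal_sup_ubound; exists x => //; rewrite RintegralB//.
Qed.

(** The weight of cell [i] in an integral from 0 to [x], with value 0 for cells beyond [x]. It is a
    sequence on all of [nat] to fit [abel_norm_le]. *)
Let len (n : nat) x (i : nat) : R :=
  Num.max 0 (Num.min x (i.+1%:R / n%:R) - i%:R / n%:R).

Let leb_cell n (n0 : (0 < n)%N) (i : nat) x : 0 <= x ->
  leb ([set` cell n i] `&` `[0, x] : set Tl) = (len n x i)%:E.
Proof.
move=> x0; rewrite leb_lebesgue /len.
have i0 : (0 : R) <= i%:R / n%:R by rewrite divr_ge0.
have ii : i%:R / n%:R < i.+1%:R / n%:R :> R by rewrite ltr_pM2r ?ltr_nat// invr_gt0 ltr0n.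
have [xi|xi] := ltP x (i.+1%:R / n%:R).
  rewrite (_ : _ `&` _ = [set` `]i%:R / n%:R, x]]).
    rewrite lebesgue_measure_itv/= lte_fin; case: ltP => h.
      by rewrite max_r ?subr_ge0 ?ltW.
    by rewrite max_l// subr_le0.
  apply/seteqP; split => s /=; rewrite !in_itv/=.
    by move=> [/andP[-> _] /andP[_ ->]].
  by move=> /andP[is_ sx]; rewrite is_ sx (le_lt_trans sx xi) (le_trans i0 (ltW is_)).
rewrite (_ : _ `&` _ = [set` cell n i]).
  by rewrite lebesgue_measure_itv/= lte_fin ii max_r ?subr_ge0 ?ltW.
apply/seteqP; split => s /=; rewrite !in_itv/=; first by case.
move=> /andP[a b]; split; first by rewrite a b.
by rewrite (le_trans i0 (ltW a))/= (le_trans (ltW b)).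
Qed.

(** [pc_fun y] equals [pc_raw y] almost everywhere, and the latter is a finite combination of
    indicators of cells. *)
Lemma Rintegral_pc_fun n (n0 : (0 < n)%N) (y : 'I_n -> R) x : 0 <= x <= 1 ->
  \int[leb]_(s in (`[0, x] : set Tl)) pc_fun y s = \sum_(i < n) y i * len n x i.
Proof.
move=> /andP[x0 x1]; have mI := measurable_itv_leb 0 x.
have -> : \int[leb]_(s in (`[0, x] : set Tl)) pc_fun y s =
    \int[leb]_(s in (`[0, x] : set Tl)) pc_raw y s.
  congr fine; apply: ae_eq_integral.
  - exact: mI.
  - by apply/measurable_EFinP; exact: measurable_pc_fun.
  - by apply/measurable_EFinP; exact: measurable_pc_raw.
  - have [N [mN N0 sN]] := ae_pc_fun y n0; exists N; split => // s /= /not_implyP[sI ne].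
    apply: sN => /= H; apply: ne; rewrite H//.
    by move: sI; rewrite !in_itv/= => /andP[-> /le_trans->].
have mC i : measurable ([set` cell n i] : set Tl).
  by apply: leb_measurable; exact: measurable_itv.
have intC (i : 'I_n) : leb.-integrable (`[0, x] : set Tl) (fun s => (\1_[set` cell n i] s)%:E).
  apply/integrableP; split; first by apply/measurable_EFinP; exact: measurable_indic.
  under eq_integral do rewrite gee0_abs ?lee_fin//.
  rewrite integral_indic//. by rewrite [X in (X < _)%E]leb_cell// ltry.
pose u (i : 'I_n) (s : Tl) : \bar R := ((y i)%:E * (\1_[set` cell n i] s)%:E)%E.
have intu : forall k, leb.-integrable (`[0, x] : set Tl) (u k).
  by move=> k; exact: (integrableZl mI _ (intC k)).
pose J : set Tl := [set` `[0, x]].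
transitivity (fine (\int[leb]_(s in J) (\sum_(j < n) u j s))%E).
  by congr fine; apply: eq_integral => s _; rewrite /pc_raw -sumEFin.
rewrite integral_sum//.
transitivity (fine (\sum_(i < n) (y i * len n x i)%:E)%E); last by rewrite sumEFin.
congr fine; apply: eq_bigr => i _.
rewrite /u integralZl// integral_indic//.
by rewrite [X in (_ * X)%E]leb_cell// EFinM.
Qed.

(** For each [x] the integral of the difference is the sum of [D i * len n x i], and [abel_norm_le]
    applies with first weight at most [1 / n]. *)
Lemma dK_pc_fun_le n (n0 : (0 < n)%N) (y z : 'I_n -> R) (D : nat -> R) (M : R) :
  (forall i : 'I_n, y i - z i = D i) ->
  (forall j, (j <= n)%N -> `|\sum_(i < j) D i| <= M) ->
  (dK (pc_fun y) (pc_fun z) <= (M / n%:R)%:E)%E.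
Proof.
move=> yzD DM; apply: ge_ereal_sup => _ [x /= xI <-].
have x01 : 0 <= x <= 1 by move: xI; rewrite in_itv.
have L u := PC_Linfty _ _ (pc_funP u n0).1.
rewrite RintegralB//; [|exact: measurable_itv_leb|exact: Linfty_integrable..].
rewrite [X in X - _](Rintegral_pc_fun n n0 y x x01).
rewrite [X in _ - X](Rintegral_pc_fun n n0 z x x01) -sumrB.
under eq_bigr do rewrite -mulrBl yzD.
have n0R : 0 < n%:R :> R by rewrite ltr0n.
(* The empty partial sum already forces [M] to be nonnegative. *)
have M0 : 0 <= M by have := DM 0%N (leq0n n); exact: le_trans.
have step i : i.+1%:R / n%:R = i%:R / n%:R + n%:R^-1 :> R.
  by rewrite -natr1 mulrDl mul1r.
have ninv : 0 < n%:R^-1 :> R by rewrite invr_gt0.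
rewrite lee_fin (le_trans (@abel_norm_le _ D (len n x) n M _ _ DM))//.
- by move=> i; rewrite /len le_max lexx.
- move=> i; rewrite /len step [i.+2%:R / _]step step.
  move: (n%:R^-1) ninv (i%:R / n%:R) => b b0 a.
  rewrite ge_max !le_max lexx/=.
  have [h1|h1] := leP x (a + b); have [h2|h2] := leP x (a + b + b); lra.
- rewrite ler_wpM2l// /len step mul0r add0r subr0 ge_max ge_min lexx orbT andbT.
  exact: ltW.
Qed.

End kolmogorov_distance.

(** * Distances to the classes of bounded modality *)

Section kolmogorov_signatures.
Context {R : realType}.

Lemma sdist_nonincreasing n (g : R -> R) (j k : nat) : (j <= k)%N ->
  (sdist n g k <= sdist n g j)%E.
Proof.
move=> jk; apply: ereal_inf_le_tmp => _ [h [hPC hm] <-]; exists h => //; split => //.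
by apply: le_trans hm _; rewrite lee_fin ler_nat.
Qed.

(** The second conjunct says that the maximum exists: if no distance drops below [tau], the
    admissible indices are unbounded and [xget] returns its default 0, which exceeds no [k]. *)
Lemma keps_gtP n (tau : R) (g : R -> R) (k : nat) :
  (k < keps n tau g)%N <->
  (tau%:E <= sdist n g k)%E /\ exists j, (sdist n g j < tau%:E)%E.
Proof.
rewrite /keps; set S := [set j | _]; split.
  case: xgetP => [[|m] _ [/= tm mmax]|//] km; first by rewrite ltn0 in km.
  split.
    by apply: le_trans tm _; exact: sdist_nonincreasing.
  exists m.+1; rewrite ltNge; apply/negP => t1.
  by have := mmax m.+2 t1; rewrite ltnn.
move=> [tk [j jt]].
have ex : exists j, (sdist n g j < tau%:E)%E by exists j.
(* Because of the index shift in [sdist_pred], the least [m] with [sdist n g m < tau] is exactly the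
   largest admissible index. *)
case: (ex_minnP ex) => m mt mmin.
have Sm : S m.
  split; first case: m mt mmin => [|m] //= mt mmin; first by rewrite leey.
    rewrite leNgt; apply/negP => /mmin; by rewrite ltnn.
  move=> [//|j'] /= tj; rewrite ltnNge; apply/negP => mj.
  have := le_lt_trans (sdist_nonincreasing n g m j' mj) mt.
  by rewrite ltNge tj.
have [_ xmax] := @xgetPex _ 0%N S (ex_intro _ m Sm).
exact: (xmax k.+1 tk).
Qed.

(** Moving each cell value by at most [r] moves the function by at most [r] in [dK]; the triangle
    inequality passes this to the infimum. *)
Lemma sdist_pc_fun_le n (n0 : (0 < n)%N) (y z : 'I_n -> R) (r : R) (j : nat) :
  (forall i, `|y i - z i| <= r) ->
  (sdist n (pc_fun y) j <= sdist n (pc_fun z) j + r%:E)%E.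
Proof.
move=> yzr.
have r0 : 0 <= r by have := yzr (Ordinal n0); exact: le_trans.
pose D i := if insub i is Some k then y k - z k else 0.
have Dr i : `|D i| <= r by rewrite /D; case: insub => [k//|]; rewrite normr0.
have dyz : (dK (pc_fun y) (pc_fun z) <= r%:E)%E.
  have n0R : 0 < n%:R :> R by rewrite ltr0n.
  rewrite -[r](mulfK (lt0r_neq0 n0R)).
  apply: (dK_pc_fun_le n n0 y z D) => [i|k kn].
    by rewrite /D valK.
  apply: (le_trans (ler_norm_sum _ _ _)); apply: (@le_trans _ _ (\sum_(i < k) r)).
    by apply: ler_sum => i _; exact: Dr.
  by rewrite sumr_const card_ord -[r *+ k]mulr_natr ler_wpM2l// ler_nat.
have L (u : 'I_n -> R) : Linfty (pc_fun u) := PC_Linfty _ _ (pc_funP u n0).1.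
rewrite -leeBlDr//; apply: le_ereal_inf_tmp => _ [h hX <-].
rewrite leeBlDr//; apply: (@le_trans _ _ (dK (pc_fun y) h)).
  by apply: ereal_inf_lbound; exists h.
have Lh : Linfty h by case: hX => /PC_Linfty.
have tri := dK_triangle _ _ _ (L y) (L z) Lh.
by rewrite (le_trans tri)// addeC leeD2l.
Qed.

End kolmogorov_signatures.

(** * Measurability of the event *)

(** An open set is a countable union of boxes with rational centre and radius, and the preimage of a
    box is a finite intersection of measurable sets. *)
Lemma measurable_open_preimage {d} {T : measurableType d} {R : realType} (n : nat)
    (Y : 'I_n -> T -> R) (U : set ('I_n -> R)) :
  (forall i, measurable_fun setT (Y i)) ->
  (forall y, U y -> exists2 r, 0 < r & forall z, (forall i, `|y i - z i| < r) -> U z) ->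
  measurable [set w | U (Y ^~ w)].
Proof.
move=> mY oU.
pose box (q : {ffun 'I_n -> rat}) (r : rat) : set ('I_n -> R) :=
  [set z | forall i, `|ratr (q i) - z i| < ratr r].
pose F (p : {ffun 'I_n -> rat} * rat) : set T :=
  if `[< box p.1 p.2 `<=` U >] then
    \bigcap_(i in setT) [set w | `|ratr (p.1 i) - Y i w| < ratr p.2] else set0.
rewrite (_ : [set w | _] = \bigcup_p F p).
  apply: countable_bigcupT_measurable => // p; rewrite /F; case: ifP => // _.
  apply: fin_bigcap_measurable => [|i _]; first exact: finite_finset.
  have md : measurable_fun setT (fun w => `|ratr (p.1 i) - Y i w|).
    by apply: measurableT_comp => //; exact: measurable_funB.
  have := measurable_fun_ltr md (measurable_cst (ratr p.2 : R)) measurableT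
    (I : measurable [set true]).
  by rewrite setTI.
apply/seteqP; split => w /=; last first.
  by move=> [p _]; rewrite /F; case: ifPn => // /asboolP pU H; apply: pU => i; exact: H.
move=> /oU[r r0 rU].
(* A box of radius below [r / 2] that contains the point stays within distance [r] of it, hence
   inside [U]. *)
have [s [s0 sr]] : exists s : rat, (0 < ratr s :> R) /\ (ratr s < r / 2).
  have r2 : 0 < r / 2 by rewrite divr_gt0.
  by have [s] := rat_in_itvoo r2; rewrite in_itv => /andP[]; exists s.
have qex i : exists q : rat, `|ratr q - Y i w| < ratr s.
  have Ys : Y i w - ratr s < Y i w + ratr s by lra.
  by have [q] := rat_in_itvoo Ys; rewrite in_itv/=  => /andP[q1 q2];
    exists q; rewrite ltr_norml; apply/andP; split; lra.
have [q qP] := choice qex.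
exists ([ffun i => q i], s) => //; rewrite /F /= ifT; last first.
  apply/asboolP => z zb; apply: rU => i.
  have := zb i; rewrite ffunE; have := qP i.
  move=> H1 H2; have -> : Y i w - z i = (ratr (q i) - z i) - (ratr (q i) - Y i w) by ring.
  by apply: le_lt_trans (ler_normB _ _) _; lra.
by move=> i _ /=; rewrite ffunE.
Qed.

(* The value of a measure on a nonmeasurable set is unspecified, so the event of
   the theorem has to be shown measurable: each sdist is Lipschitz in the cell
   values, hence {sdist < tau} is open in them. *)
Lemma measurable_keps {d} {T : measurableType d} {R : realType} (n : nat)
    (n0 : (0 < n)%N) (Y : 'I_n -> T -> R) (tau : R) (k : nat) :
  (forall i, measurable_fun setT (Y i)) ->
  measurable [set w | (k < keps n tau (pc_fun (Y ^~ w)))%N].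
Proof.
move=> mY.
have m j : measurable [set w | (sdist n (pc_fun (Y ^~ w)) j < tau%:E)%E].
  apply: (measurable_open_preimage n Y [set y | (sdist n (pc_fun y) j < tau%:E)%E] mY) => y /= ylt.
  have [r r0 yr] : exists2 r : R, 0 < r & (sdist n (pc_fun y) j + r%:E < tau%:E)%E.
    move: ylt; case: (sdist n (pc_fun y) j) => [c| |]//.
    - rewrite lte_fin => ct; exists ((tau - c) / 2); first by lra.
      by rewrite -EFinD lte_fin; lra.
    - by move=> _; exists 1 => //; rewrite ltNyr.
  exists r; first exact: r0.
  move=> z zr.
  have zyr i : `|z i - y i| <= r by rewrite distrC ltW.
  exact: le_lt_trans (sdist_pc_fun_le n n0 z y r j zyr) yr.
rewrite (_ : [set w | _] = ~` [set w | (sdist n (pc_fun (Y ^~ w)) k < tau%:E)%E] `&`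
    \bigcup_j [set w | (sdist n (pc_fun (Y ^~ w)) j < tau%:E)%E]).
  by apply: measurableI; [exact: measurableC|exact: bigcupT_measurable].
apply/seteqP; split => w /=.
  by move=> /keps_gtP[tk [j jt]]; split; [apply/negP; rewrite -leNgt|exists j].
by move=> [/negP]; rewrite -leNgt => tk [j _ jt]; apply/keps_gtP; split => //; exists j.
Qed.

(** * The threshold and the final bound *)

Lemma threshold_expR {R : realType} (kappa v alpha : R) (n : nat) :
  (0 < n)%N -> 0 < kappa -> 0 < v -> 0 < alpha < 1 ->
  let x := n%:R * threshold kappa v n alpha in
  0 < x /\ 2 * expR (- (x ^+ 2 / (2 * (n%:R * v + kappa * x)))) = alpha.
Proof.
move=> n0 k0 v0 /andP[a0 a1] x.
have a2 : 0 < alpha / 2 by rewrite divr_gt0.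
have L0 : ln (alpha / 2) < 0 by rewrite ln_lt0// a2/=; lra.
set L := ln (alpha / 2) in L0 *.
have n0R : 0 < n%:R :> R by rewrite ltr0n.
have xE : x = Num.sqrt (L * (L * kappa ^+ 2 - 2 * n%:R * v)) - kappa * L.
  by rewrite /x /threshold mulVKf// gt_eqF.
set q := L * (L * kappa ^+ 2 - 2 * n%:R * v) in xE.
have q0 : 0 <= q.
  rewrite /q nmulr_rge0//.
  have : 0 <= n%:R * v by rewrite mulr_ge0// ltW.
  have : L * kappa ^+ 2 <= 0 by rewrite nmulr_rle0// sqr_ge0.
  by rewrite -mulrA; lra.
have kL : kappa * L < 0 by rewrite pmulr_rlt0.
have x0 : 0 < x by rewrite xE; have := sqrtr_ge0 q; lra.
split => //.
have D0 : 0 < n%:R * v + kappa * x by rewrite addr_gt0// mulr_gt0.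
(* Isolating the square root and squaring gives this quadratic equation; the exponent is then
   exactly [L], and [2 * expR L = alpha]. *)
have x2 : x ^+ 2 = - L * (2 * (n%:R * v + kappa * x)).
  have H : (x + kappa * L) ^+ 2 = q by rewrite xE subrK sqr_sqrtr.
  have -> : x ^+ 2 = (x + kappa * L) ^+ 2 - 2 * kappa * L * x - (kappa * L) ^+ 2 by ring.
  by rewrite H /q; ring.
rewrite x2 mulfK ?opprK; last by rewrite gt_eqF// mulr_gt0.
by rewrite lnK ?posrE// mulrC divfK.
Qed.

Theorem theorem3 (R : realType) (d : measure_display) (T : measurableType d)
  (P : probability T R)
  (X : set (R -> R)) (hX : X `<=` calL)
  (f : R -> R) (hf : X f)
  (n : nat) (hn : (1 <= n)%N)
  (alpha : R) (halpha : 0 < alpha < 1)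
  (kappa v : R) (hkappa : 0 < kappa) (hv : 0 < v)
  (eps : 'I_n -> {RV P >-> R})
  (hindep : independent_family eps)
  (hmean : forall i : 'I_n, ('E_P[eps i] = 0)%E)
  (hmoment : forall (i : 'I_n) (m : nat), (2 <= m)%N ->
    ('E_P[fun w => (`|eps i w| ^+ m)%R] <=
      ((v * (m`!)%:R * kappa ^+ (m - 2) / 2)%R)%:E)%E)
  (Y : 'I_n -> T -> R)
  (hY : forall (i : 'I_n) (w : T), Y i w = f (i%:R / n%:R) + eps i w)
  (k : nat)
  (hk : Xmodes n k (pc_fun (fun i : 'I_n => f (i%:R / n%:R)))) :
  (P [set w | (k < keps n (threshold kappa v n alpha)
                        (pc_fun (fun i : 'I_n => Y i w)))%N] <= alpha%:E)%E.
Proof.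
case: n hn eps hindep hmean hmoment Y hY hk => // m hn eps hindep hmean hmoment Y hY hk.
have eqY : Y = fun i w => f (i%:R / m.+1%:R) + eps i w.
  by apply/funext => i; apply/funext => w; exact: hY.
have mY i : measurable_fun setT (Y i) by rewrite eqY; exact: measurable_funD.
have [x0 xalpha] := threshold_expR kappa v alpha m.+1 hn hkappa hv halpha.
set tau := threshold kappa v m.+1 alpha in x0 xalpha *.
set x := m.+1%:R * tau in x0 xalpha.
have mA := measurable_keps m.+1 hn Y tau k mY.
rewrite -[alpha in leRHS]xalpha.
(* The noise as a sequence on [nat]: [inord] sends indices from [m.+1] on to 0, so the mean and
   moment bounds hold for every index. *)
pose e i := eps (inord i).
apply: (bernstein_maximal P e m.+1 kappa v) => //.
- move=> B mB; have := hindep [set: 'I_m.+1]%SET (fun i => B i) (fun i => mB i).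
  rewrite (eq_bigl xpredT); last by move=> i; rewrite inE.
  rewrite (_ : \bigcap_(i in _) _ = \bigcap_(i in `I_m.+1) (e i @^-1` B i)).
    by move=> ->; apply: eq_bigr => i _; rewrite /e inord_val.
  apply/seteqP; split => w /= H i.
    by move=> ilt; have := H (inord i); rewrite /= inE inordK//; exact.
  by move=> _; have := H i (ltn_ord i); rewrite /e inord_val.
- by move=> i; exact: hmean.
- by move=> i; exact: hmoment.
move=> w /= /keps_gtP[tk _]; apply: contrapT => nex.
have lt j : (j <= m.+1)%N -> `|\sum_(i < j) e i w| < x.
  by move=> jm; rewrite ltNge; apply/negP => xj; apply: nex; exists j.
pose M := \big[Num.max/0]_(j < m.+2) `|\sum_(i < j) e i w|.
(* A maximum of finitely many values below [x] is below [x]; this strict gap is what contradicts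
   [tau <= M / n]. *)
have Mx : M < x by apply: bigmax_lt => // j _; apply: lt; rewrite -ltnS.
have n0R : 0 < m.+1%:R :> R by rewrite ltr0n.
have : (tau%:E <= (M / m.+1%:R)%:E)%E.
  apply: (le_trans tk); apply: le_trans; last first.
    apply: (dK_pc_fun_le m.+1 hn (Y ^~ w) (fun i => f (i%:R / m.+1%:R)) (fun i => e i w) M).
      by move=> i; rewrite hY addrC addKr /e inord_val.
    by move=> j jm; apply: (le_bigmax _ (fun j : 'I_m.+2 => `|\sum_(i < j) e i w|)
      (Ordinal (jm : (j < m.+2)%N))).
  (* By [hk], the discretized signal itself competes in the infimum that defines [sdist]. *)
  by apply: ereal_inf_lbound; exists (pc_fun (fun i : 'I_m.+1 => f (i%:R / m.+1%:R))).
by rewrite lee_fin ler_pdivlMr// mulrC leNgt Mx.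
Qed.
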